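(* Let $\mathcal{F}$ be the filter monad on $\mathbf{Set}$, i.e. the monad induced by the dual adjunction $\mathbf{Set}(-,2)\dashv\mathbf{MSL}(-,2)\colon\mathbf{MSL}^{\mathrm{op}}\to\mathbf{Set}$, so $\mathcal{F}X=\mathbf{MSL}(\mathbf{Set}(X,2),2)$ is the set of filters on $X$. Then $\mathcal{F}$ is the codensity monad of the forgetful functor $U\colon\mathbf{MSL}_{\mathsf f}\to\mathbf{Set}$, and $\mathcal{F}$ is also the codensity monad of the functor $U_{\mathcal{P}_{\mathsf f}}\colon\mathbf{Kl}_{\mathsf f}(\mathcal{P}_{\mathsf f})\to\mathbf{Set}$.
   Context: $\mathbf{MSL}$ is the category of meet-semilattices with top element and maps preserving finite meets and top; $\mathbf{MSL}_{\mathsf f}$ is its full subcategory of finite ones. $2=\{0,1\}$ is the two-element meet-semilattice (meet = minimum). $\mathbf{Set}(X,2)$ carries the pointwise meet-semilattice structure, and $\mathbf{MSL}(M,2)$ is a set; a morphism $M\to 2$ corresponds to a filter (nonempty, upward closed, meet-closed subset) of $M$. $\mathcal{P}_{\mathsf f}$ is the finite power set monad on $\mathbf{Set}$; $\mathbf{Kl}_{\mathsf f}(\mathcal{P}_{\mathsf f})$ is the full subcategory of its Kleisli category on finite sets (objects finite sets, morphisms $f\colon X\to\mathcal{P}_{\mathsf f}Y$ with Kleisli composition), and $U_{\mathcal{P}_{\mathsf f}}$ sends $X$ to $\mathcal{P}_{\mathsf f}X$ and $f$ to $f^\#\colon A\mapsto\bigcup_{x\in A}f(x)$. The codensity monad of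 a functor $F$ is the right Kan extension $\mathrm{Ran}_FF$ with its canonical monad structure induced by the universal property (unit corresponding to $\mathrm{id}_F$, multiplication corresponding to the twofold counit); ''is the codensity monad'' means isomorphic as monads. *)

(* Defs.v *)
From HB Require Import structures.
From mathcomp Require Import all_boot all_order.
From mathcomp Require Import boolp classical_sets functions cardinality.

Set Implicit Arguments.
Unset Strict Implicit.
Unset Printing Implicit Defensive.

Import Order.TTheory.

Local Open Scope classical_set_scope.

(* Equality of arrows is Leibniz equality; for functions it is extensional   *)
(* by the axioms of boolp.                                                   *)

Record category := Category {
  ob :> Type;
  hom : ob -> ob -> Type;
  idm : forall x, hom x x;
  compm : forall x y z, hom y z -> hom x y -> hom x z;
  compmA : forall x y z t (h : hom z t) (g : hom y z) (f : hom x y),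
    compm h (compm g f) = compm (compm h g) f;
  comp1m : forall x y (f : hom x y), compm (idm y) f = f;
  compm1 : forall x y (f : hom x y), compm f (idm x) = f }.

Arguments hom {c} x y.
Arguments idm {c} x.
Arguments compm {c x y z} g f : rename.
Notation "g \oc f" := (compm g f)
  (at level 50, left associativity, format "g  \oc  f").

Definition opposite (C : category) : category :=
  @Category C (fun x y => hom y x) (fun x => idm x)
    (fun x y z g f => f \oc g)
    (fun _ _ _ _ h g f => esym (compmA f g h))
    (fun _ _ f => compm1 f) (fun _ _ f => comp1m f).

Definition full_subcategory (C : category) (P : C -> Prop) : category :=
  @Category {x : C | P x} (fun x y => hom (sval x) (sval y))
    (fun x => idm (sval x)) (fun x y z g f => g \oc f)
    (fun _ _ _ _ h g f => compmA h g f)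
    (fun _ _ f => comp1m f) (fun _ _ f => compm1 f).

Record functor (C D : category) := Functor {
  fob :> C -> D;
  fmap : forall x y, hom x y -> hom (fob x) (fob y);
  fmap1 : forall x, fmap (idm x) = idm (fob x);
  fmapM : forall x y z (g : hom y z) (f : hom x y),
    fmap (g \oc f) = fmap g \oc fmap f }.

Arguments fmap {C D} f {x y} _ : rename.

Definition fid (C : category) : functor C C :=
  @Functor C C id (fun _ _ f => f) (fun=> erefl) (fun _ _ _ _ _ => erefl).

Section FunctorComp.
Variables (C D E : category) (G : functor D E) (F : functor C D).

Lemma fcomp_fmap1 x : fmap G (fmap F (idm x)) = idm (G (F x)).
Proof. by rewrite !fmap1. Qed.

Lemma fcomp_fmapM x y z (g : hom y z) (f : hom x y) :
  fmap G (fmap F (g \oc f)) = fmap G (fmap F g) \oc fmap G (fmap F f).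
Proof. by rewrite !fmapM. Qed.

Definition fcomp : functor C E :=
  @Functor C E (fun x => G (F x)) (fun _ _ f => fmap G (fmap F f))
    fcomp_fmap1 fcomp_fmapM.
End FunctorComp.

Notation "G \of F" := (fcomp G F)
  (at level 50, left associativity, format "G  \of  F").

Definition full_inclusion (C : category) (P : C -> Prop) :
    functor (full_subcategory P) C :=
  @Functor (full_subcategory P) C sval (fun _ _ f => f)
    (fun=> erefl) (fun _ _ _ _ _ => erefl).

Record nattrans (C D : category) (F G : functor C D) := NatTrans {
  ncomp :> forall x, hom (F x) (G x);
  naturality : forall x y (f : hom x y),
    ncomp y \oc fmap F f = fmap G f \oc ncomp x }.

Arguments NatTrans {C D F G} ncomp naturality.

Record monad (C : category) := Monad {
  monad_functor :> functor C C;
  munit : nattrans (fid C) monad_functor;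
  mmult : nattrans (monad_functor \of monad_functor) monad_functor;
  mmultA : forall x,
    mmult x \oc fmap monad_functor (mmult x) = mmult x \oc mmult (monad_functor x);
  mmult_unitl : forall x, mmult x \oc munit (monad_functor x) = idm _;
  mmult_unitr : forall x, mmult x \oc fmap monad_functor (munit x) = idm _ }.

Arguments munit {C} m : rename.
Arguments mmult {C} m : rename.

Lemma munit_natural (C : category) (T : monad C) (x y : C) (f : hom x y) :
  munit T y \oc f = fmap T f \oc munit T x.
Proof. exact: (naturality (munit T)). Qed.

Lemma mmult_natural (C : category) (T : monad C) (x y : C) (f : hom x y) :
  mmult T y \oc fmap T (fmap T f) = fmap T f \oc mmult T x.
Proof. exact: (naturality (mmult T)). Qed.

Definition is_monad_morphism (C : category) (S T : monad C)
    (t : nattrans S T) : Prop :=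
  (forall x, t x \oc munit S x = munit T x) /\
  (forall x, t x \oc mmult S x = mmult T x \oc (fmap T (t x) \oc t (S x))).

Definition monad_iso (C : category) (S T : monad C) : Prop :=
  exists (t : nattrans S T) (u : nattrans T S),
    [/\ is_monad_morphism t, is_monad_morphism u,
        forall x, u x \oc t x = idm (S x) &
        forall x, t x \oc u x = idm (T x)].

Record adjunction (C D : category) (L : functor C D) (R : functor D C) :=
  Adjunction {
    adj_unit : nattrans (fid C) (R \of L);
    adj_counit : nattrans (L \of R) (fid D);
    adj_triangleL : forall x,
      adj_counit (L x) \oc fmap L (adj_unit x) = idm (L x);
    adj_triangleR : forall y,
      fmap R (adj_counit y) \oc adj_unit (R y) = idm (R y) }.

Section MonadOfAdjunction.
Variables (C D : category) (L : functor C D) (R : functor D C).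
Variable A : adjunction L R.

Let T := R \of L.

Lemma adj_mult_natural x y (f : hom x y) :
  fmap R (adj_counit A (L y)) \oc fmap (T \of T) f =
  fmap T f \oc fmap R (adj_counit A (L x)).
Proof. by rewrite /= -!fmapM; congr (fmap R _); exact: (naturality (adj_counit A)). Qed.

Definition adj_mult : nattrans (T \of T) T :=
  @NatTrans _ _ (T \of T) T (fun x => fmap R (adj_counit A (L x)))
    adj_mult_natural.

Lemma adj_multA x :
  adj_mult x \oc fmap T (adj_mult x) = adj_mult x \oc adj_mult (T x).
Proof.
by rewrite /= -!fmapM; congr (fmap R _); rewrite (naturality (adj_counit A)).
Qed.

Lemma adj_mult_unitr x : adj_mult x \oc fmap T (adj_unit A x) = idm _.
Proof. by rewrite /= -fmapM adj_triangleL fmap1. Qed.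

Definition monad_of_adjunction : monad C :=
  @Monad C T (adj_unit A) adj_mult adj_multA
    (fun x => adj_triangleR A (L x)) adj_mult_unitr.
End MonadOfAdjunction.

(* Right Kan extension of G along K: a functor with a counit through which   *)
(* every nattrans (H \of K) G factors uniquely.                              *)

Record right_kan (A B C : category) (K : functor A B) (G : functor A C) :=
  RightKan {
    ran :> functor B C;
    ran_counit : nattrans (ran \of K) G;
    ran_lift : forall H : functor B C, nattrans (H \of K) G -> nattrans H ran;
    ran_liftK : forall (H : functor B C) (a : nattrans (H \of K) G) x,
      ran_counit x \oc ran_lift a (K x) = a x;
    ran_lift_unique : forall (H : functor B C) (a : nattrans (H \of K) G)
        (b : nattrans H ran),
      (forall x, ran_counit x \oc b (K x) = a x) ->
      forall y, b y = ran_lift a y }.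

Arguments ran_counit {A B C K G} r : rename.
Arguments ran_lift {A B C K G} r {H} a : rename.
Arguments ran_liftK {A B C K G} r {H} a x : rename.
Arguments ran_lift_unique {A B C K G r H a b} _ y : rename.

Lemma ran_counit_natural (A B C : category) (K : functor A B)
    (G : functor A C) (E : right_kan K G) x y (f : hom x y) :
  ran_counit E y \oc fmap E (fmap K f) = fmap G f \oc ran_counit E x.
Proof. exact: (naturality (ran_counit E)). Qed.

Lemma ran_nat_eq (A B C : category) (K : functor A B) (G : functor A C)
    (E : right_kan K G) (H : functor B C) (b b' : nattrans H E) :
  (forall x, ran_counit E x \oc b (K x) = ran_counit E x \oc b' (K x)) ->
  forall y, b y = b' y.
Proof.
move=> bb'.
have nat x y (f : hom x y) :
    (ran_counit E y \oc b' (K y)) \oc fmap (H \of K) f =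
    fmap G f \oc (ran_counit E x \oc b' (K x)).
  by rewrite -compmA (naturality b') !compmA ran_counit_natural.
move=> y; rewrite (ran_lift_unique (a := NatTrans _ nat) bb').
by rewrite -(ran_lift_unique (a := NatTrans _ nat) (b := b')).
Qed.

(* The unit is the lift of id_F, the multiplication the lift of the twofold  *)
(* counit e . Ran e : Ran (Ran F) -> F.                                      *)

Section CodensityMonad.
Variables (C D : category) (F : functor C D) (E : right_kan F F).

Let e := ran_counit E.

Lemma id_natural x y (f : hom x y) :
  idm (F y) \oc fmap (fid D \of F) f = fmap F f \oc idm (F x).
Proof. by rewrite comp1m compm1. Qed.

Definition codensity_unit : nattrans (fid D) E :=
  ran_lift E (@NatTrans _ _ (fid D \of F) F (fun x => idm (F x)) id_natural).

Lemma counit2_natural x y (f : hom x y) :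
  (e y \oc fmap E (e y)) \oc fmap ((E \of E) \of F) f =
  fmap F f \oc (e x \oc fmap E (e x)).
Proof.
rewrite /= -compmA -fmapM ran_counit_natural fmapM !compmA.
by rewrite -ran_counit_natural.
Qed.

Definition codensity_mult : nattrans (E \of E) E :=
  ran_lift E (@NatTrans _ _ ((E \of E) \of F) F
    (fun x => e x \oc fmap E (e x)) counit2_natural).

Let cu_natural x y (f : hom x y) :
  codensity_unit y \oc f = fmap E f \oc codensity_unit x.
Proof. exact: (naturality codensity_unit). Qed.

Let cm_natural x y (f : hom x y) :
  codensity_mult y \oc fmap E (fmap E f) = fmap E f \oc codensity_mult x.
Proof. exact: (naturality codensity_mult). Qed.

Let eu x : e x \oc codensity_unit (F x) = idm (F x).
Proof. exact: ran_liftK. Qed.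

Let em x : e x \oc codensity_mult (F x) = e x \oc fmap E (e x).
Proof. exact: ran_liftK. Qed.

Lemma codensity_multA x :
  codensity_mult x \oc fmap E (codensity_mult x) =
  codensity_mult x \oc codensity_mult (E x).
Proof.
have n1 y z (f : hom y z) :
    (codensity_mult z \oc fmap E (codensity_mult z)) \oc
      fmap ((E \of E) \of E) f =
    fmap E f \oc (codensity_mult y \oc fmap E (codensity_mult y)).
  rewrite /= -compmA -fmapM cm_natural fmapM !compmA.
  by rewrite -cm_natural.
have n2 y z (f : hom y z) :
    (codensity_mult z \oc codensity_mult (E z)) \oc
      fmap ((E \of E) \of E) f =
    fmap E f \oc (codensity_mult y \oc codensity_mult (E y)).
  rewrite -compmA cm_natural !compmA.
  by rewrite cm_natural.
apply: (ran_nat_eq (b := NatTrans _ n1) (b' := NatTrans _ n2)) => y /=.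
rewrite !compmA em -!compmA -fmapM em fmapM.
by rewrite -cm_natural !compmA em.
Qed.

Lemma codensity_mult_unitl x :
  codensity_mult x \oc codensity_unit (E x) = idm _.
Proof.
have n1 y z (f : hom y z) :
    (codensity_mult z \oc codensity_unit (E z)) \oc fmap E f =
    fmap E f \oc (codensity_mult y \oc codensity_unit (E y)).
  rewrite -compmA cu_natural !compmA.
  by rewrite cm_natural.
have n2 y z (f : hom y z) : idm _ \oc fmap E f = fmap E f \oc idm _.
  by rewrite comp1m compm1.
apply: (ran_nat_eq (b := NatTrans _ n1) (b' := NatTrans _ n2)) => y /=.
rewrite compmA em -compmA -cu_natural.
by rewrite compmA eu comp1m compm1.
Qed.

Lemma codensity_mult_unitr x :
  codensity_mult x \oc fmap E (codensity_unit x) = idm _.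
Proof.
have n1 y z (f : hom y z) :
    (codensity_mult z \oc fmap E (codensity_unit z)) \oc fmap E f =
    fmap E f \oc (codensity_mult y \oc fmap E (codensity_unit y)).
  rewrite -compmA -fmapM cu_natural fmapM !compmA.
  by rewrite cm_natural.
have n2 y z (f : hom y z) : idm _ \oc fmap E f = fmap E f \oc idm _.
  by rewrite comp1m compm1.
apply: (ran_nat_eq (b := NatTrans _ n1) (b' := NatTrans _ n2)) => y /=.
by rewrite compmA em -compmA -fmapM eu fmap1.
Qed.

Definition codensity_monad : monad D :=
  @Monad D E codensity_unit codensity_mult codensity_multA
    codensity_mult_unitl codensity_mult_unitr.
End CodensityMonad.

Definition is_codensity_monad (C D : category) (T : monad D)
    (F : functor C D) : Prop :=
  exists E : right_kan F F, monad_iso T (codensity_monad E).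

Section Kleisli.
Variables (C : category) (T : monad C).

Definition kl_hom (x y : C) := hom x (T y).
Definition kl_comp x y z (g : kl_hom y z) (f : kl_hom x y) : kl_hom x z :=
  mmult T z \oc (fmap T g \oc f).

Lemma kl_compA x y z t (h : kl_hom z t) (g : kl_hom y z) (f : kl_hom x y) :
  kl_comp h (kl_comp g f) = kl_comp (kl_comp h g) f.
Proof.
rewrite /kl_comp !fmapM !compmA mmultA.
by rewrite -(compmA _ (mmult T (T t))) mmult_natural !compmA.
Qed.

Lemma kl_comp1m x y (f : kl_hom x y) : kl_comp (munit T y) f = f.
Proof. by rewrite /kl_comp compmA mmult_unitr comp1m. Qed.

Lemma kl_compm1 x y (f : kl_hom x y) : kl_comp f (munit T x) = f.
Proof.
by rewrite /kl_comp -munit_natural compmA mmult_unitl comp1m.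
Qed.

Definition kleisli : category :=
  @Category C kl_hom (munit T) kl_comp kl_compA kl_comp1m kl_compm1.

Definition kl_ext (x y : C) (f : kl_hom x y) : hom (T x) (T y) :=
  mmult T y \oc fmap T f.

Lemma kl_ext1 x : kl_ext (munit T x) = idm (T x).
Proof. exact: mmult_unitr. Qed.

Lemma kl_extM x y z (g : kl_hom y z) (f : kl_hom x y) :
  kl_ext (kl_comp g f) = kl_ext g \oc kl_ext f.
Proof.
rewrite /kl_ext /kl_comp !fmapM !compmA mmultA.
by rewrite -(compmA _ (mmult T (T z))) mmult_natural !compmA.
Qed.

Definition kleisli_forget : functor kleisli C :=
  @Functor kleisli C T kl_ext kl_ext1 kl_extM.
End Kleisli.

Definition Set_cat : category :=
  @Category Type (fun X Y => X -> Y) (fun X => @id X)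
    (fun X Y Z g f => fun x => g (f x))
    (fun _ _ _ _ _ _ _ => erefl) (fun _ _ _ => erefl) (fun _ _ _ => erefl).

(* Meet-semilattices with top.  The order display is part of the object, so  *)
(* that no restriction is put on it.                                         *)

Local Open Scope order_scope.

Record msl := MSL {
  msl_display : Order.disp_t;
  msl_sort :> tMeetSemilatticeType msl_display }.

Record msl_hom (M N : msl) := MSLHom {
  msl_fun :> M -> N;
  msl_funI : forall x y : M, msl_fun (x `&` y) = msl_fun x `&` msl_fun y;
  msl_fun1 : msl_fun \top = \top }.

Lemma msl_homP (M N : msl) (f g : msl_hom M N) : (forall x, f x = g x) -> f = g.
Proof.
case: f g => [f fI f1] [g gI g1] /= /funext fg.
by subst g; congr MSLHom; apply: Prop_irrelevance.
Qed.

Definition msl_id (M : msl) : msl_hom M M :=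
  @MSLHom M M id (fun _ _ => erefl) erefl.

Section MSLComp.
Variables (M N P : msl) (g : msl_hom N P) (f : msl_hom M N).

Lemma msl_compI x y : g (f (x `&` y)) = g (f x) `&` g (f y).
Proof. by rewrite !msl_funI. Qed.

Lemma msl_comp1 : g (f \top) = \top.
Proof. by rewrite !msl_fun1. Qed.

Definition msl_comp : msl_hom M P := MSLHom msl_compI msl_comp1.
End MSLComp.

Definition MSL_cat : category.
Proof.
refine (@Category msl msl_hom msl_id msl_comp _ _ _);
  by move=> *; apply: msl_homP.
Defined.

Definition MSL_forget : functor MSL_cat Set_cat :=
  @Functor MSL_cat Set_cat (fun M : msl => (M : Type))
    (fun M N (f : msl_hom M N) => (f : M -> N))
    (fun=> erefl) (fun _ _ _ _ _ => erefl).

Definition MSLf : category :=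
  @full_subcategory MSL_cat (fun M : msl => finite_set [set: M]).

Definition U_MSLf : functor MSLf Set_cat :=
  MSL_forget \of @full_inclusion MSL_cat _.

(* The library orders function types pointwise, with pointwise meet; only    *)
(* the top element is missing.                                               *)

Section FunTop.
Variables (X : Type) (d : Order.disp_t) (T : tLatticeType d).

Lemma fun_lex1 (f : X -> T) : f <= (fun=> \top).
Proof. by apply/lefP => x; apply: lex1. Qed.

HB.instance Definition _ :=
  Order.hasTop.Build FunOrder.fun_display (X -> T) fun_lex1.
End FunTop.

(* The functors Set(-,2) and MSL(-,2) are contravariant; they are encoded    *)
(* as covariant functors to and from the opposite of MSL_cat.  On bool the   *)
(* library order is false <= true, so meet is && and top is true.            *)

Definition two : msl := @MSL _ bool.

Definition two_pow (X : Type) : msl := @MSL _ (X -> bool).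

Definition two_pow_map (X Y : Type) (f : X -> Y) :
    msl_hom (two_pow Y) (two_pow X) :=
  @MSLHom (two_pow Y) (two_pow X) (fun A x => A (f x))
    (fun _ _ => erefl) erefl.

Definition Set_two : functor Set_cat (opposite MSL_cat).
Proof.
refine (@Functor Set_cat (opposite MSL_cat) two_pow two_pow_map _ _);
  by move=> *; apply: msl_homP.
Defined.

Definition MSL_two : functor (opposite MSL_cat) Set_cat.
Proof.
refine (@Functor (opposite MSL_cat) Set_cat
  (fun M : msl => msl_hom M two)
  (fun (M N : msl) (f : msl_hom N M) (h : msl_hom M two) => msl_comp h f) _ _);
  by move=> *; apply: funext => h; apply: msl_homP.
Defined.

Definition ev_point (X : Type) (x : X) : msl_hom (two_pow X) two :=
  @MSLHom (two_pow X) two (fun A => A x) (fun _ _ => erefl) erefl.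

Section EvMSL.
Variable M : msl.
Let ev (m : M) : two_pow (msl_hom M two) := fun h => h m.

Let evI m m' : ev (m `&` m') = ev m `&` ev m'.
Proof. by apply: funext => h; rewrite /ev msl_funI. Qed.

Let ev1 : ev \top = \top.
Proof. by apply: funext => h; rewrite /ev msl_fun1. Qed.

Definition ev_msl : msl_hom M (two_pow (msl_hom M two)) := MSLHom evI ev1.
End EvMSL.

Definition dual_unit : nattrans (fid Set_cat) (MSL_two \of Set_two).
Proof.
refine (@NatTrans _ _ (fid Set_cat) (MSL_two \of Set_two) ev_point _).
by move=> X Y f; apply: funext => x; apply: msl_homP.
Defined.

Definition dual_counit : nattrans (Set_two \of MSL_two) (fid (opposite MSL_cat)).
Proof.
refine (@NatTrans _ _ (Set_two \of MSL_two) (fid (opposite MSL_cat)) ev_msl _).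
by move=> M N f; apply: msl_homP.
Defined.

Definition dual_adjunction : adjunction Set_two MSL_two.
Proof.
refine (@Adjunction _ _ Set_two MSL_two dual_unit dual_counit _ _).
- by move=> X; apply: msl_homP.
- by move=> M; apply: funext => h; apply: msl_homP.
Defined.

Definition filter_monad : monad Set_cat := monad_of_adjunction dual_adjunction.

Local Close Scope order_scope.

Definition Pf (X : Type) : Type := {A : set X | finite_set A}.

Lemma Pf_eq (X : Type) (A B : Pf X) : sval A = sval B -> A = B.
Proof. by case: A B => [A fA] [B fB] /= AB; apply: eq_exist. Qed.

Definition Pf_map (X Y : Type) (f : X -> Y) (A : Pf X) : Pf Y :=
  exist _ (f @` sval A) (finite_image f (svalP A)).

Definition Pf_unit (X : Type) (x : X) : Pf X := exist _ [set x] (finite_set1 x).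

Definition Pf_mult (X : Type) (A : Pf (Pf X)) : Pf X :=
  exist _ (\bigcup_(B in sval A) sval B)
    (bigcup_finite (svalP A) (fun B _ => svalP B)).

Definition Pf_functor : functor Set_cat Set_cat.
Proof.
refine (@Functor Set_cat Set_cat Pf Pf_map _ _).
- by move=> X; apply: funext => A; apply: Pf_eq; rewrite /= image_id.
- move=> X Y Z g f; apply: funext => A; apply: Pf_eq => /=.
  by rewrite -image_comp.
Defined.

Definition Pf_munit : nattrans (fid Set_cat) Pf_functor.
Proof.
refine (@NatTrans _ _ (fid Set_cat) Pf_functor Pf_unit _).
by move=> X Y f; apply: funext => x; apply: Pf_eq; rewrite /= image_set1.
Defined.

Definition Pf_mmult : nattrans (Pf_functor \of Pf_functor) Pf_functor.
Proof.
refine (@NatTrans _ _ (Pf_functor \of Pf_functor) Pf_functor Pf_mult _).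
move=> X Y f; apply: funext => A; apply: Pf_eq => /=.
by rewrite bigcup_image image_bigcup.
Defined.

Definition Pf_monad : monad Set_cat.
Proof.
refine (@Monad Set_cat Pf_functor Pf_munit Pf_mmult _ _ _).
- move=> X; apply: funext => A; apply: Pf_eq => /=.
  rewrite bigcup_image; apply/seteqP; split => x.
  + by move=> [B AB [D BD Dx]]; exists D => //; exists B.
  + by move=> [D [B AB BD] Dx]; exists B => //; exists D.
- by move=> X; apply: funext => A; apply: Pf_eq; rewrite /= bigcup_set1.
- move=> X; apply: funext => A; apply: Pf_eq => /=.
  rewrite bigcup_image; apply/seteqP; split => x.
  + by move=> [y Ay /= ->].
  + by move=> Ax; exists x.
Defined.

Definition Klf_Pf : category :=
  @full_subcategory (kleisli Pf_monad) (fun X : Type => finite_set [set: X]).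

Definition U_Pf : functor Klf_Pf Set_cat :=
  kleisli_forget Pf_monad \of @full_inclusion (kleisli Pf_monad) _.

(* U_Pf sends X to Pf X by construction; on arrows it is the usual union.    *)
Lemma U_PfE (X Y : Klf_Pf) (f : hom X Y) (A : Pf (sval X)) :
  sval (fmap U_Pf f A : Pf (sval Y)) = \bigcup_(x in sval A) sval (f x : Pf _).
Proof. by rewrite /= bigcup_image. Qed.

(* Main.v *)
(* Both parts are instances of one criterion.  Let V : C -> Set have an      *)
(* object t with V t = 2 such that the maps V f : V c -> V t are jointly     *)
(* injective, and suppose that every filter phi on V c has a limit point x,  *)
(* with V f x = phi (V f) for all f : c -> t.  Taking limits is the counit   *)
(* F V -> V.  A transformation a : H V -> V lifts to H -> F by               *)
(* s |-> (A |-> a_t (H A s)); this value preserves finite meets in A because *)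
(* the meet of 2 and its constant 1 come from arrows of C.  For finite       *)
(* meet-semilattices, and for the sets Pf X with union as meet, limits exist *)
(* because every map V c -> 2 in question is a finite meet of simple ones.   *)

From mathcomp Require Import all_boot all_order.
From mathcomp Require Import boolp classical_sets functions cardinality.
Require Import Defs.

Set Implicit Arguments.
Unset Strict Implicit.
Unset Printing Implicit Defensive.

Import Order.TTheory.

Local Open Scope classical_set_scope.

(** An element of [Ran_V V] at [X] amounts to a natural family of operations taking maps [X -> V c]
    to points of [V c]. Arrows to [t] separate points, so the family is determined by its component
    at [t], a map from [2^X] to [2]; naturality along the arrows for meet and top makes this map a
    filter. Conversely, a filter acts on every [V c] through limits, which exist by finiteness
    ([finite_msl_limit], [Pf_limit]). [filter_kan] verifies the universal property directly, and
    [filter_is_codensity] matches the monad structures. *)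

Lemma fmap_comp (C : category) (V : functor C Set_cat) c d e
    (g : hom d e) (f : hom c d) (z : V c) :
  fmap V (g \oc f) z = fmap V g (fmap V f z).
Proof. by rewrite fmapM. Qed.

Lemma naturality_at (C : category) (F G : functor C Set_cat)
    (a : nattrans F G) c d (f : hom c d) (z : F c) :
  a d (fmap F f z) = fmap G f (a c z).
Proof. by have /(congr1 (@^~ z)) := naturality a f. Qed.

(** * The criterion: filters as a right Kan extension *)

Section FilterCodensity.
Variables (C : category) (V : functor C Set_cat).
Variables (t q : C) (i : V t -> bool) (j : bool -> V t).
Hypotheses (jK : cancel j i) (iK : cancel i j).
Variables (p1 p2 m : hom q t) (k : hom t t) (pair : bool -> bool -> V q).
Hypothesis p1_pair : forall a b, fmap V p1 (pair a b) = j a.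
Hypothesis p2_pair : forall a b, fmap V p2 (pair a b) = j b.
Hypothesis i_meet : forall z,
  i (fmap V m z) = i (fmap V p1 z) && i (fmap V p2 z).
Hypothesis i_top : forall z, i (fmap V k z) = true.
Hypothesis sep : forall c (x y : V c),
  (forall f : hom c t, i (fmap V f x) = i (fmap V f y)) -> x = y.
Hypothesis limit_ex : forall c (phi : msl_hom (two_pow (V c)) two),
  exists x : V c, forall f : hom c t,
    i (fmap V f x) = phi (fun z => i (fmap V f z)).

Let F : functor Set_cat Set_cat := MSL_two \of Set_two.

(** The choice is harmless: limits are unique by [sep], which also yields naturality. *)
Definition limit c (phi : F (V c)) : V c := sval (cid (limit_ex phi)).

Lemma limitE c (phi : F (V c)) (f : hom c t) :
  i (fmap V f (limit phi)) = (phi : msl_hom _ _) (fun z => i (fmap V f z)).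
Proof. exact: (svalP (cid (limit_ex phi))). Qed.

Lemma limit_natural c d (f : hom c d) :
  (@limit d : hom (F (V d)) (V d)) \oc fmap (F \of V) f =
  fmap V f \oc (@limit c : hom (F (V c)) (V c)).
Proof.
apply: funext => phi; apply: sep => g.
rewrite limitE /= -fmap_comp limitE /=; congr (msl_fun phi _).
by apply: funext => z; rewrite /= fmap_comp.
Qed.

Definition limit_nat : nattrans (F \of V) V :=
  @NatTrans _ _ (F \of V) V limit limit_natural.

Section Lift.
Variables (H : functor Set_cat Set_cat) (a : nattrans (H \of V) V).

Lemma test_natural c (f : hom c t) X (A : X -> V c) (s : H X) :
  i (a t (fmap H (fun x => fmap V f (A x) : V t) s)) =
  i (fmap V f (a c (fmap H A s))).
Proof.
rewrite -naturality_at; congr (i (a t _)).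
exact: (@fmap_comp Set_cat H X (V c) (V t)).
Qed.

Definition lift_fun X (s : H X) : two_pow X -> two :=
  fun A => i (a t (fmap H ((fun x => j (A x)) : hom (X : Set_cat) (V t)) s)).

(** [V q] stands in for 2 x 2: pairing [A] with [B] sends [s] to a single point of [V q], after
    applying [a], whose tests by [p1], [p2] and [m] are the three values involved. *)
Lemma lift_funI X (s : H X) (A B : two_pow X) :
  lift_fun s (A `&` B)%O = (lift_fun s A `&` lift_fun s B)%O.
Proof.
pose P x := pair (A x) (B x).
have test f G : (forall x, fmap V f (P x) = j (G x)) ->
    lift_fun s G = i (fmap V f (a q (fmap H P s))).
  move=> fG; rewrite -test_natural; congr (i (a t (fmap H _ s))).
  by apply: funext => x; rewrite fG.
rewrite (test p1 A) => [|x]; last exact: p1_pair.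
rewrite (test p2 B) => [|x]; last exact: p2_pair.
rewrite (test m) => [|x]; first exact: i_meet.
by apply: (can_inj iK); rewrite i_meet p1_pair p2_pair !jK.
Qed.

Lemma lift_fun1 X (s : H X) : lift_fun s \top%O = \top%O.
Proof.
pose jtrue : hom (X : Set_cat) (V t) := fun=> j true.
rewrite -[RHS](i_top (a t (fmap H jtrue s))).
rewrite -test_natural; congr (i (a t (fmap H _ s))).
by apply: funext => x; apply: (can_inj iK); rewrite i_top jK.
Qed.

Definition lift X (s : H X) : F X := MSLHom (lift_funI s) (lift_fun1 s).

Lemma lift_natural X Y (f : hom X Y) :
  (@lift Y : hom (H Y) (F Y)) \oc fmap H f =
  fmap F f \oc (@lift X : hom (H X) (F X)).
Proof.
apply: funext => s; apply: msl_homP => A; congr (i (a t _)).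
exact: esym (@fmap_comp Set_cat H X Y (V t) (fun y => j (A y)) f s).
Qed.

Definition lift_nat : nattrans H F := @NatTrans _ _ H F lift lift_natural.

Lemma lift_natK c : limit_nat c \oc lift_nat (V c) = a c.
Proof.
apply: funext => s; apply: sep => f; rewrite limitE /= /lift_fun.
under [X in fmap H X]funext => z do rewrite iK.
by rewrite -naturality_at.
Qed.

Lemma lift_nat_unique (b : nattrans H F) :
  (forall c, limit_nat c \oc b (V c) = a c) -> forall X, b X = lift_nat X.
Proof.
move=> ba X; apply: funext => s; apply: msl_homP => A /=.
pose jA : hom (X : Set_cat) (V t) := fun x => j (A x).
rewrite /lift_fun -ba -/jA /=.
(* Naturality of [b] along [jA] moves the question to [V t], where the test by the identity of [t]
   recovers the value at [A]. *)
rewrite naturality_at.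
have := limitE (fmap F jA (b X s)) (idm t); rewrite fmap1 /= => ->.
by congr (msl_fun (b X s) _); apply: funext => x; rewrite /= jK.
Qed.
End Lift.

Definition filter_kan : right_kan V V :=
  @RightKan _ _ _ V V F limit_nat lift_nat lift_natK lift_nat_unique.

Lemma filter_unitE X : munit filter_monad X = codensity_unit filter_kan X.
Proof.
apply: (@ran_lift_unique _ _ _ V V filter_kan) => c.
by apply: funext => x; apply: sep => f; rewrite limitE.
Qed.

(** The limit of a flattened filter of filters is the limit of the limits, and this equation
    determines the codensity multiplication. *)
Lemma filter_multE X : mmult filter_monad X = codensity_mult filter_kan X.
Proof.
apply: (@ran_lift_unique _ _ _ V V filter_kan (F \of F)) => c.
apply: funext => Phi; apply: sep => f; rewrite !limitE /=.
by congr (msl_fun Phi _); apply: funext => phi; rewrite /= limitE.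
Qed.

Lemma filter_is_codensity : is_codensity_monad filter_monad V.
Proof.
exists filter_kan.
(* The Kan extension is carried by the filter functor itself, so identities give the isomorphism. *)
have idN X Y (f : hom X Y) : idm (F Y) \oc fmap F f = fmap F f \oc idm (F X).
  by [].
exists (@NatTrans _ _ filter_monad (codensity_monad filter_kan) _ idN).
exists (@NatTrans _ _ (codensity_monad filter_kan) filter_monad _ idN).
split=> //; split=> X.
- exact: filter_unitE.
- rewrite fmap1; exact: filter_multE.
- exact: esym (filter_unitE X).
- rewrite fmap1; exact: esym (filter_multE X).
Qed.
End FilterCodensity.

Lemma filter_all (Y : Type) (phi : msl_hom (two_pow Y) two) (I : Type)
    (h : I -> Y -> bool) (s : seq I) :
  phi (fun z => all (h^~ z) s) = all (fun x => phi (h x)) s.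
Proof.
elim: s => [|x s IHs] /=; first exact: (msl_fun1 phi).
by rewrite -IHs; exact: (msl_funI phi).
Qed.

(** * Finite meet-semilattices *)

Section MSLf.

Lemma msl_hom_meets (M : msl) (f : msl_hom M two) (s : seq M) (P : pred M) :
  f (\meet_(x <- s | P x) x)%O = all (fun x => P x ==> f x) s.
Proof.
elim: s => [|x s IHs]; first by rewrite big_nil msl_fun1.
by rewrite big_cons /=; case: ifP => _ //=; rewrite msl_funI IHs.
Qed.

(** On a finite set, [phi] is generated by the set of points whose complement is not in [phi]; the
    limit is the meet of that set. *)
Lemma finite_msl_limit (M : msl) : finite_set [set: M] ->
  forall phi : msl_hom (two_pow M) two,
  exists x : M, forall f : msl_hom M two, f x = phi f.
Proof.
move=> /finite_seqP[s sP] phi.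
have sM x : x \in s by have : [set: M] x by []; rewrite sP.
(* A subset [f] is the intersection of the complements of the points outside it. *)
exists (\meet_(x <- s | ~~ phi (fun z => z != x)) x)%O => f.
rewrite msl_hom_meets.
transitivity (all (fun x => phi (fun z => f x || (z != x))) s).
  apply: eq_all => x; case: (f x) => /=; last by rewrite implybF negbK.
  by rewrite implybT; apply: esym; exact: (msl_fun1 phi).
rewrite -filter_all; congr (msl_fun phi _); apply: funext => z.
apply/allP/idP => [/(_ z (sM z))|fz x _]; first by rewrite eqxx orbF.
by case: (eqVneq z x) => [<-|_]; rewrite ?fz ?orbT.
Qed.

Lemma principalI (M : msl) (x y z : M) :
  ((x <= y `&` z) = ((x <= y) `&` (x <= z) : bool))%O.
Proof. by rewrite lexI. Qed.

(** By antisymmetry, these maps separate the points of [M]. *)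
Definition principal (M : msl) (x : M) : msl_hom M two :=
  @MSLHom M two (fun y => x <= y)%O (principalI x) (lex1 x).

Lemma bool_meetI (f g : two_pow bool) :
  (((f `&` g) true && (f `&` g) false) =
   ((f true && f false) `&` (g true && g false) : bool))%O.
Proof. exact: andbACA. Qed.

Definition bool_meet : msl_hom (two_pow bool) two :=
  @MSLHom (two_pow bool) two (fun f => f true && f false) bool_meetI erefl.

Definition two_top : msl_hom two two :=
  @MSLHom two two (fun=> true) (fun _ _ => erefl) erefl.

Lemma finite_two : finite_set [set: two].
Proof. exact: (@finite_finset bool). Qed.

Lemma finite_two_pow_bool : finite_set [set: two_pow bool].
Proof.
pose g (u : bool * bool) : bool -> bool := fun c => if c then u.1 else u.2.
have -> : [set: two_pow bool] = g @` [set: bool * bool].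
  apply/seteqP; split=> // f _; exists (f true, f false) => //.
  by apply: funext => -[].
exact/finite_image/finite_finset.
Qed.

Lemma filter_codensity_MSLf : is_codensity_monad filter_monad U_MSLf.
Proof.
pose t : MSLf := exist _ two finite_two.
pose q : MSLf := exist _ (two_pow bool) finite_two_pow_bool.
apply: (@filter_is_codensity MSLf U_MSLf t q id id _ _
  (ev_point true) (ev_point false) bool_meet two_top
  (fun a b => fun c : bool => if c then a else b)) => //.
- move=> [M fM] x y /= xy; apply: le_anti.
  by have := xy (principal x); have := xy (principal y); rewrite /= !lexx => -> <-.
- by move=> [M fM] phi; exact: finite_msl_limit.
Qed.
End MSLf.

(** * Finite power sets and Kleisli arrows *)

Section Pf.

Definition finPf (T : finType) (A : set T) : Pf T :=
  exist _ A finite_finset.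

(* Identifies Pf 1 with 2 so that the empty set is 1 and union becomes meet. *)
Definition avoids (A : Pf unit) : bool := `[< ~ sval A tt >].

Definition coavoids (b : bool) : Pf unit := finPf [set _ | ~~ b].

(** Coordinates are read by absence, as in [avoids]: [true] is missing iff [a] holds, [false] iff
    [b] does. *)
Definition pf_pair (a b : bool) : Pf bool :=
  finPf [set c : bool | ~~ (if c then a else b)].

Lemma coavoidsK : cancel coavoids avoids.
Proof. by move=> b; apply/asboolP/idP => /=; case: b. Qed.

Lemma avoidsK : cancel avoids coavoids.
Proof.
move=> A; apply: Pf_eq; apply/seteqP; split=> -[] /=.
  by move/asboolPn/contrapT.
by move=> Att; apply/asboolPn => /(_ Att).
Qed.

Lemma U_Pf_mem (X Y : Klf_Pf) (f : hom X Y) (A : Pf (sval X)) (y : sval Y) :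
  sval (fmap U_Pf f A : Pf (sval Y)) y <->
  exists2 x, sval A x & sval (f x : Pf (sval Y)) y.
Proof. by rewrite U_PfE. Qed.

Lemma finite_finType (T : finType) : finite_set [set: T].
Proof. exact: finite_finset. Qed.

Definition Kl_unit : Klf_Pf := exist _ (unit : Type) (finite_finType unit).
Definition Kl_bool : Klf_Pf := exist _ (bool : Type) (finite_finType bool).

Lemma avoidsE (X : Klf_Pf) (f : hom X Kl_unit) (A : Pf (sval X)) :
  avoids (fmap U_Pf f A) =
  `[< forall x, sval A x -> ~ sval (f x : Pf unit) tt >].
Proof.
apply: asbool_equiv_eq; split.
- by move=> nf x Ax fx; apply: nf; apply/(@U_Pf_mem X Kl_unit); exists x.
- by move=> nf /(@U_Pf_mem X Kl_unit)[x Ax fx]; exact: nf fx.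
Qed.

(** An arrow to [Kl_unit] is a subset of [X], and its test is disjointness from it: a finite meet of
    tests for missing one point. The limit collects the points whose test is not in [phi]. *)
Lemma Pf_limit (X : Klf_Pf) (phi : msl_hom (two_pow (Pf (sval X))) two) :
  exists A : Pf (sval X), forall f : hom X Kl_unit,
    avoids (fmap U_Pf f A) = phi (fun B => avoids (fmap U_Pf f B)).
Proof.
pose e : set (sval X) := [set x | ~~ phi (fun B => `[< ~ sval B x >])].
have fe : finite_set e by apply: sub_finite_set (svalP X).
exists (exist _ e fe) => f; rewrite avoidsE /=.
have [s sP] : exists s : seq {classic (sval X)}, [set: sval X] = [set` s].
  exact/(@finite_seqP {classic (sval X)})/(svalP X).
have sX (x : {classic (sval X)}) : x \in s.
  by have : [set: sval X] x by []; rewrite sP.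
(* The test of f is the meet over x of the tests h x. *)
pose h (x : {classic (sval X)}) (B : Pf (sval X)) : bool :=
  ~~ `[< sval (f x : Pf unit) tt >] || `[< ~ sval B x >].
have -> : (fun B : Pf (sval X) => avoids (fmap U_Pf f B)) =
    fun B => all (h^~ B) s.
  apply: funext => B; rewrite avoidsE /=.
  apply/asboolP/allP => [Bf x _|Bf x Bx fx].
  - rewrite /h -implybE; apply/implyP => /asboolP fx.
    by apply/asboolP => /Bf; apply.
  - by have := Bf x (sX x); rewrite /h => /orP[/asboolPn|/asboolP]; apply.
rewrite filter_all; apply/asboolP/allP => [ef x _|ef x /negP ex fx].
- have [fx|nfx] := pselect (sval (f x : Pf unit) tt).
    have -> : h x = fun B => `[< ~ sval B x >].
      by apply: funext => B; rewrite /h (asboolT fx).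
    by apply: contrapT => /negP ex; exact: ef fx.
  have -> : h x = \top%O by apply: funext => B; rewrite /h (asboolF nfx).
  by rewrite msl_fun1.
- apply: ex; have := ef x (sX x); congr (is_true (msl_fun phi _)).
  by apply: funext => B; rewrite /h (asboolT fx).
Qed.

Lemma Pf_separated (X : Klf_Pf) (A B : Pf (sval X)) :
  (forall f : hom X Kl_unit,
     avoids (fmap U_Pf f A) = avoids (fmap U_Pf f B)) -> A = B.
Proof.
move=> AB; apply: Pf_eq; apply/funext => x; apply/propext.
(* The arrow for the singleton of [x] tests membership of [x]. *)
pose f : hom X Kl_unit := fun y => finPf [set _ : unit | y = x].
have fE D : avoids (fmap U_Pf f D) = `[< ~ sval D x >].
  rewrite avoidsE; apply: asbool_equiv_eq; split=> [nD Dx|nD y Dy /= yx].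
  - exact: nD Dx erefl.
  - by apply: nD; rewrite -yx.
have [nAB nBA] : ~ sval A x <-> ~ sval B x.
  by apply: asbool_eq_equiv; rewrite -!fE AB.
by split=> [Ax|Bx]; apply: contrapT; [move/nBA; apply|move/nAB; apply].
Qed.

Lemma filter_codensity_Pf : is_codensity_monad filter_monad U_Pf.
Proof.
(* As subsets of [bool], [p1], [p2] and [m] are the singletons of [true] and [false] and their
   union; avoiding the union is the meet. Everything avoids the empty set, hence [k]. *)
pose p1 : hom Kl_bool Kl_unit := fun b => finPf [set _ | b].
pose p2 : hom Kl_bool Kl_unit := fun b => finPf [set _ | ~~ b].
pose m : hom Kl_bool Kl_unit := fun=> finPf setT.
pose k : hom Kl_unit Kl_unit := fun=> finPf set0.
apply: (@filter_is_codensity Klf_Pf U_Pf Kl_unit Kl_bool avoids coavoids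
  coavoidsK avoidsK p1 p2 m k pf_pair).
- move=> a b; apply: (can_inj avoidsK); rewrite coavoidsK avoidsE.
  apply/asboolP/idP => [/(_ true) /=|aT [] //=]; last by rewrite aT.
  by case: a => // /(_ isT isT).
- move=> a b; apply: (can_inj avoidsK); rewrite coavoidsK avoidsE.
  apply/asboolP/idP => [/(_ false) /=|bT [] //=]; last by rewrite bT.
  by case: b => // /(_ isT isT).
- move=> z; rewrite !avoidsE; apply/asboolP/andP => /= [nz|[]].
  + by split; apply/asboolP => x /nz nx _; exact: nx.
  + by move=> /asboolP n1 /asboolP n2 [] zx _; [exact: n1 zx _|exact: n2 zx _].
- by move=> z; rewrite avoidsE; apply/asboolP => x _.
- exact: Pf_separated.
- exact: Pf_limit.
Qed.
End Pf.

Theorem theorem4p3 :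
  is_codensity_monad filter_monad U_MSLf /\
  is_codensity_monad filter_monad U_Pf.
Proof. by split; [exact: filter_codensity_MSLf|exact: filter_codensity_Pf]. Qed.
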